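(* Let $\mathcal A_1$ be a separable Hilbert space and let $\mathcal A_2$ be a separable Hilbert space continuously injected into $\mathcal A_1$. Then $\mathcal A_2$ (identified with its image) is a Borel set of $\mathcal A_1$. *)

(* Defs.v *)
From HB Require Import structures.
From mathcomp Require Import all_boot all_order all_algebra.
From mathcomp Require Import complex.
From mathcomp Require Import all_classical all_reals all_analysis.

Set Implicit Arguments.
Unset Strict Implicit.
Unset Printing Implicit Defensive.

Import Order.TTheory GRing.Theory Num.Theory.
Import numFieldNormedType.Exports.

Local Open Scope classical_set_scope.
Local Open Scope ring_scope.

(* Hilbert spaces may be real or complex; [theta] is the conjugation of the
   scalar field, i.e. the identity in the real case. *)
Inductive real_or_complex (R : realType) :
    forall K : numFieldType, (K -> K) -> Prop :=
| RealScalars : real_or_complex R (idfun : R -> R)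
| ComplexScalars : real_or_complex R (Num.conj : R[i] -> R[i]).

HB.mixin Record NormedModule_isHilbert (K : numFieldType) (theta : K -> K) V
    of CompleteNormedModule K V := {
  inner : {dot V for theta} ;
  sqr_norm_inner : forall x : V, `|x| ^+ 2 = inner x x
}.

#[short(type="hilbertType")]
HB.structure Definition Hilbert (K : numFieldType) (theta : K -> K) :=
  {V of CompleteNormedModule K V & NormedModule_isHilbert K theta V}.

Definition separable (T : topologicalType) : Prop :=
  exists2 D : set T, countable D & dense D.

Definition borel_set (T : topologicalType) (A : set T) : Prop :=
  <<s [set U : set T | open U] >> A.

(* Main.v *)
(* The range of iota is the union of the images of the balls |x| <= n, so it is
   enough that the closure of each of these images stays in the range; the range
   is then F_sigma.  Let y be in the closure of the image of a ball B.  The sets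
   C_k = {x in B : |iota x - y| <= 1/(k+1)} are nonempty, convex, bounded and
   decreasing.  By the parallelogram law, almost norm-minimal elements of the C_k
   form a Cauchy sequence, and iota maps its limit to y. *)
Require Import Defs.
From mathcomp Require Import all_boot all_order all_algebra.
From mathcomp Require Import complex.
From mathcomp Require Import all_classical all_reals all_analysis.
From mathcomp Require Import ring lra.

Import Order.TTheory GRing.Theory Num.Theory.
Import numFieldNormedType.Exports.
Local Open Scope classical_set_scope.
Local Open Scope ring_scope.

(* The norms live in [K], where suprema need not exist when [K = R[i]]; they are
   all images of elements of [R]. *)
Lemma scalar_embedding (R : realType) (K : numFieldType) (theta : K -> K) :
  real_or_complex R theta ->
  exists emb : {rmorphism R -> K},
    {mono emb : x y / x <= y} /\ forall z : K, 0 <= z -> exists r, emb r = z.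
Proof.
case.
  by exists (idfun : {rmorphism R -> R}); split=> // z _; exists z.
exists (real_complex R : {rmorphism R -> R[i]}); split=> [x y|[a b]].
  exact: lecR.
by rewrite lecE /= => /andP[/eqP -> _]; exists a.
Qed.

Lemma parallelogram (K : numFieldType) (theta : K -> K)
    (V : hilbertType theta) (x y : V) :
  `|x - y| ^+ 2 + `|x + y| ^+ 2 = 2 * `|x| ^+ 2 + 2 * `|y| ^+ 2.
Proof.
rewrite !sqr_norm_inner linearBl linearDl /= !linearBr !linearDr /=.
ring.
Qed.

(** The infima of the squared norms over the [C n] are nondecreasing and bounded, hence convergent;
    for near-minimizers, midpoint stability bounds their distances by the growth of these infima.
    The limit need not lie in any [C n]. *)
Lemma convergent_selection (R : realType) (K : numFieldType) (theta : K -> K)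
    (hK : real_or_complex R theta) (V : hilbertType theta)
    (C : nat -> set V) (M : K) :
  (forall m n, (m <= n)%N -> C n `<=` C m) ->
  (forall n, C n !=set0) ->
  (forall n x, C n x -> `|x| <= M) ->
  (forall n x y, C n x -> C n y -> C n (2^-1 *: (x + y))) ->
  exists u : nat -> V, (forall n, C n (u n)) /\ cvgn u.
Proof.
move=> Cdecr C0 CM Cmid.
have [emb [emb_le emb_ge0]] := scalar_embedding _ _ _ hK.
have emb_lt := leW_mono emb_le.
have emb_inj : injective emb by exact: fmorph_inj.
(* [q] is the squared norm pulled back to [R], where infima exist. *)
have /choice[q qE] : forall x : V, exists r, emb r = `|x| ^+ 2.
  by move=> x; exact/emb_ge0/exprn_ge0.
have q_ge0 x : 0 <= q x by rewrite -emb_le rmorph0 qE exprn_ge0.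
have q_par x y : q (x - y) + 4 * q (2^-1 *: (x + y)) = 2 * q x + 2 * q y.
  apply: emb_inj; rewrite !(rmorphD, rmorphM, rmorph_nat) !qE -parallelogram.
  by rewrite normrZ exprMn normfV normr_nat; field.
pose d n := inf (q @` C n).
have qC_inf n : has_inf (q @` C n).
  split; first by have [x Cx] := C0 n; exists (q x), x.
  by exists 0 => _ [x _ <-].
have d_le n x : C n x -> d n <= q x.
  by move=> Cx; apply: ge_inf; [case: (qC_inf n)|exists x].
have /choice[u uP] : forall n, exists x, C n x /\ q x < d n + n.+1%:R^-1.
  move=> n.
  have [|_ [x Cx <-] lt_x] := @inf_adherent _ _ (n.+1%:R^-1) _ (qC_inf n).
    by rewrite invr_gt0.
  by exists x.
exists u; split; first by move=> n; case: (uP n).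
have d_homo : {homo d : m n / (m <= n)%N >-> m <= n}.
  move=> m n mn; apply: lb_le_inf; first by case: (qC_inf n).
  by move=> _ [x Cx <-]; apply/d_le/(Cdecr _ _ mn).
have M_ge0 : 0 <= M by have [x /CM] := C0 0; exact: le_trans.
have [m mE] := emb_ge0 _ M_ge0.
have d_cvg : cvgn d.
  apply: nondecreasing_is_cvgn => //; exists (m ^+ 2) => _ [n _ <-].
  have [x Cx] := C0 n; apply: le_trans (d_le n x Cx) _.
  rewrite -emb_le qE rmorphXn /= mE.
  by rewrite ler_sqr ?nnegrE //; exact: CM Cx.
have d_lim n : d n <= limn d by exact: nondecreasing_cvgn_le.
apply/cauchy_cvgP/cauchy_exP => eps eps0.
have [e eE] := emb_ge0 _ (ltW eps0).
have e0 : 0 < e by rewrite -emb_lt rmorph0 eE.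
(* For [k <= j] the midpoint of [u k] and [u j] is in [C k], so [q_par] gives q(u k - u j) < 2 (d j
   - d k) + 2/(k+1) + 2/(j+1) <= 2 (lim d - d k) + 4/(k+1). With both quantities below e^2/8 this is
   less than 6 e^2/8. *)
have e2 : 0 < e ^+ 2 / 8 by rewrite divr_gt0 ?exprn_gt0.
have [k [dk ik]] : exists k,
    limn d - d k < e ^+ 2 / 8 /\ k.+1%:R^-1 < e ^+ 2 / 8.
  have : \forall k \near \oo,
      limn d - d k < e ^+ 2 / 8 /\ k.+1%:R^-1 < e ^+ 2 / 8.
    near=> k; split; last by near: k; exact: near_infty_natSinv_lt (PosNum e2).
    apply: le_lt_trans (ler_norm _) _.
    by near: k; exact: cvgr_dist_lt d_cvg _ e2.
  by case=> k _ /(_ k (leqnn k)); exists k.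
exists (u k); exists k => // j /= kj.
rewrite -ball_normE /= -eE.
rewrite -(@ltr_pXn2r _ 2) ?nnegrE // ?eE; last exact: ltW.
rewrite -eE -qE -rmorphXn emb_lt.
have [uk qk] := uP k; have [uj qj] := uP j.
have jk : j.+1%:R^-1 <= k.+1%:R^-1 :> R by rewrite lef_pV2 ?posrE ?ler_nat.
have := q_par (u k) (u j).
have := d_le k _ (Cmid _ _ _ uk (Cdecr _ _ kj _ uj)).
have := d_lim j.
move: (k.+1%:R^-1) (j.+1%:R^-1) jk ik qk qj => ? ? ? ? ? ?.
lra.
Unshelve. all: by end_near.
Qed.

Lemma closure_image_ball (R : realType) (K : numFieldType) (theta : K -> K)
    (hK : real_or_complex R theta) (V W : hilbertType theta)
    (f : {linear V -> W}) (M : K) :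
  continuous f ->
  closure (f @` [set x | `|x| <= M]) `<=` range f.
Proof.
move=> f_cont y y_cl.
have [emb [emb_le emb_ge0]] := scalar_embedding _ _ _ hK.
have emb_lt := leW_mono emb_le.
pose C n := [set x : V | `|x| <= M /\ `|f x - y| <= n.+1%:R^-1].
(* Stated for any [U] because it serves in [V] for the norm bound and in [W] for the distance to
   [y]. *)
have half_mid (U : normedModType K) (a b : U) r :
    `|a| <= r -> `|b| <= r -> `|2^-1 *: (a + b)| <= r.
  move=> ar br; rewrite normrZ normfV normr_nat ler_pdivrMl ?ltr0n //.
  by rewrite mulr_natl mulr2n (le_trans (ler_normD _ _)) ?lerD.
have [||||u [uC u_cvg]] := @convergent_selection R K theta hK V C M.
- move=> m n mn x [xM xn]; split=> //; apply: le_trans xn _.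
  by rewrite lef_pV2 ?posrE ?ler_nat ?ltr0n.
- move=> n.
  have [|_ [[x xM <-] fx]] := y_cl (ball y n.+1%:R^-1).
    by apply: nbhsx_ballx; rewrite invr_gt0 ltr0n.
  exists x; split=> //; rewrite distrC.
  by move: fx; rewrite -ball_normE /=; exact: ltW.
- by move=> n x [].
- move=> n a b [aM an] [bM bn]; split; first exact: half_mid.
  have -> : f (2^-1 *: (a + b)) - y = 2^-1 *: ((f a - y) + (f b - y)).
    rewrite linearZ_LR linearD addrACA -opprD scalerBr -[y + y]mulr2n.
    by rewrite -[y *+ 2]scaler_nat scalerA mulVf ?pnatr_eq0 // scale1r.
  exact: half_mid.
exists (limn u) => //.
have fu_lim : f \o u @ \oo --> f (limn u).
  by apply: continuous_cvg => //; exact: f_cont.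
have fu_y : f \o u @ \oo --> y.
  apply/cvgrPdist_lt => eps eps0; have [e eE] := emb_ge0 _ (ltW eps0).
  have e0 : 0 < e by rewrite -emb_lt rmorph0 eE.
  near=> n; have [_ un] := uC n.
  rewrite distrC; apply: le_lt_trans un _.
  (* Both sides come from [R], where 1/(n+1) is eventually below [e]. *)
  rewrite -(rmorph_nat emb) -fmorphV -eE emb_lt.
  by near: n; exact: near_infty_natSinv_lt (PosNum e0).
exact: (@cvg_unique _ (@norm_hausdorff _ W) _ _ _ _ fu_lim fu_y).
Unshelve. all: by end_near.
Qed.

Lemma closed_borel (T : topologicalType) (A : set T) : closed A -> borel_set A.
Proof.
move=> A_closed; rewrite -(setCK A) -setTD.
have A_open : <<s [set U : set T | open U] >> (~` A).
  by apply: sub_sigma_algebra; exact: closed_openC.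
exact: sigma_algebraCD.
Qed.

Theorem lemma5p9 (R : realType) (K : numFieldType) (theta : K -> K)
    (hK : real_or_complex R theta)
    (A1 A2 : hilbertType theta)
    (sepA1 : separable A1) (sepA2 : separable A2)
    (iota : {linear A2 -> A1})
    (iota_cont : continuous iota) (iota_inj : injective iota) :
  borel_set (range iota).
Proof.
have -> : range iota = \bigcup_n closure (iota @` [set x | `|x| <= n%:R]).
  apply/seteqP; split=> [_ [x _ <-]|y [n _]]; last first.
    exact: (closure_image_ball _ _ _ hK).
  (* A natural number above the norm of [x] is found by truncating its preimage in [R]. *)
  have [emb [emb_le emb_ge0]] := scalar_embedding _ _ _ hK.
  have [r rE] := emb_ge0 _ (normr_ge0 x).
  exists (Num.truncn r).+1 => //; apply: (@subset_closure A1); exists x => //=.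
  by rewrite -rE -(rmorph_nat emb) emb_le ltW // truncnS_gt.
apply: sigma_algebra_bigcup => n.
by apply: closed_borel; exact: closed_closure.
Qed.
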